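(* Let $k\geq 1$ be an integer and let $\beta=(\beta_1,\dots,\beta_a)$ be a vector of nonnegative integers of length $a$ with $\sum_{i=1}^a i\beta_i=k$. Then $$\sum_{\alpha\in\mathcal{C}_{k,\beta}} H(\alpha) = h(\beta).$$
   Context: A composition of $k$ is a finite sequence $\alpha=(\alpha_1,\dots,\alpha_l)$ of positive integers (of any length $l$) with sum $k$. $\mathcal{C}_{k,\beta}$ is the set of all compositions $\alpha$ of $k$ such that $\#\{j:\alpha_j=i\}=\beta_i$ for every $i=1,\dots,a$ (and no part exceeds $a$). For a composition $\alpha=(\alpha_1,\dots,\alpha_l)$, $$H(\alpha) = \bigl(\alpha_1(\alpha_1+\alpha_2)\cdots(\alpha_1+\cdots+\alpha_l)\bigr)^{-1},$$ and $$h(\beta)=\left(\prod_{i=1}^a i^{\beta_i}\,\beta_i!\right)^{-1}.$$ *)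

(* Defs.v *)
From HB Require Import structures.
From mathcomp Require Import all_boot all_order all_algebra.

Set Implicit Arguments.
Unset Strict Implicit.
Unset Printing Implicit Defensive.

Import GRing.Theory.
Local Open Scope ring_scope.

Definition is_composition (k : nat) (s : seq nat) : bool :=
  all (fun p => 0 < p)%N s && (sumn s == k).

Record composition (k : nat) := Composition {
  parts :> seq nat;
  _ : is_composition k parts
}.

HB.instance Definition _ k := [isSub for @parts k].
HB.instance Definition _ k := [Countable of composition k by <:].

Lemma size_composition k (alpha : composition k) : (size alpha <= k)%N.
Proof.
case: alpha => s /= /andP[pos_s /eqP<-].
by elim: s pos_s => //= p s IHs /andP[p_gt0 /IHs le_s]; rewrite -addn1 addnC leq_add.
Qed.

Lemma part_le_composition k (alpha : composition k) p :
  p \in (alpha : seq nat) -> (p <= k)%N.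
Proof.
case: alpha => s /= /andP[_ /eqP<-].
elim: s => //= q s IHs; rewrite inE => /predU1P[->|/IHs]; first exact: leq_addr.
by move=> le_p; rewrite (leq_trans le_p) ?leq_addl.
Qed.

(* Finiteness: a composition of k has at most k parts, each at most k. *)
Definition composition_bseq k (alpha : composition k) : {bseq k of 'I_k.+1} :=
  insub_bseq k [seq inord p | p <- alpha].

Definition bseq_composition k (b : {bseq k of 'I_k.+1}) : option (composition k) :=
  insub [seq val p | p <- b].

Lemma composition_bseqK k : pcancel (@composition_bseq k) (@bseq_composition k).
Proof.
move=> alpha; rewrite /bseq_composition /composition_bseq.
rewrite /insub_bseq val_insubd size_map size_composition.
rewrite -map_comp (_ : map _ _ = val alpha) ?valK // -[RHS]map_id.
by apply/eq_in_map => p /part_le_composition le_p /=; rewrite inordK.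
Qed.

HB.instance Definition _ k : isFinite (composition k) :=
  PCanIsFinite (@composition_bseqK k).

(* Vectors are indexed from 0: the multiplicity beta_i of the part i is
   [beta j] with i = j.+1. *)
Definition compositions_of_type (k a : nat) (beta : {ffun 'I_a -> nat}) :
    {set composition k} :=
  [set alpha : composition k |
     [forall j : 'I_a, count_mem j.+1 alpha == beta j]
     && all (fun p => p <= a)%N alpha].

Definition H (alpha : seq nat) : rat :=
  (\prod_(j < size alpha) (\sum_(i < j.+1) nth 0 alpha i)%N%:R)^-1.

Definition h (a : nat) (beta : {ffun 'I_a -> nat}) : rat :=
  (\prod_(j < a) (j.+1%:R ^+ beta j * (beta j)`!%:R))^-1.

(* Main.v *)
Require Import Defs.
From mathcomp Require Import all_boot all_order all_algebra.
Import GRing.Theory Num.Theory.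
Local Open Scope ring_scope.

(** The identity is a recursion on the last part.  If [p] is the last part of
    [alpha], the last factor of [H alpha] is the total [k], so
    [H alpha = H alpha' / k] with [alpha'] the composition without [p]
    ([H_rcons]).  On the other side, lowering the multiplicity of [p] by one
    multiplies [h] by [p] times that multiplicity ([h_part_mult_rem]).  Grouping
    the compositions by their last part and arguing by induction, the sum is
    [h beta / k] times the sum of [p * beta_p] over the possible parts [p]; this
    last sum is [k], and the claim follows.  The recursion ends at the empty
    composition, where both sides are empty products.

    The induction runs over arrangements of a multiset: the compositions of
    type [beta] are the distinct rearrangements of a sequence in which each part
    [i] occurs [beta_i] times ([mem_compositions_of_type]), and fixing the last
    entry of a rearrangement leaves a rearrangement of the sequence with that
    entry removed ([permutations_rcons]). *)

Lemma permutations_rcons (T : eqType) (s : seq T) : (0 < size s)%N ->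
  perm_eq (permutations s)
          [seq rcons t x | x <- undup s, t <- permutations (rem x s)].
Proof.
move=> s_gt0; apply: uniq_perm; first exact: permutations_uniq.
  apply: allpairs_uniq_dep; first exact: undup_uniq.
    by move=> x _; apply: permutations_uniq.
  by move=> [x t] [y u] _ _ /= /rcons_inj [-> ->].
move=> u; rewrite mem_permutations; apply/idP/allpairsPdep => [|[x [t []]]].
  case/lastP: u => [/perm_size|t x us]; first by move=> s0; rewrite -s0 in s_gt0.
  have xs : x \in s by rewrite -(perm_mem us) mem_rcons mem_head.
  exists x, t; rewrite mem_undup mem_permutations; split=> //.
  rewrite -(perm_cons x) -(permPr (perm_to_rem xs)).
  by rewrite perm_sym -(permPl us) perm_rcons.
rewrite mem_undup mem_permutations => xs ts ->.
by rewrite perm_rcons (permPr (perm_to_rem xs)) perm_cons.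
Qed.

Lemma H_rcons (s : seq nat) (p : nat) :
  H (rcons s p) = H s / (sumn (rcons s p))%:R.
Proof.
rewrite /H size_rcons big_ord_recr /= invfM; congr (_^-1 * (_%:R)^-1).
  apply: eq_bigr => j _; congr (_%:R); apply: eq_bigr => i _.
  by rewrite nth_rcons (leq_trans (ltn_ord i) (ltn_ord j)).
by rewrite sumnE (big_nth 0%N) size_rcons big_mkord.
Qed.

(** Multiplicities are recorded as a vector of the shape that [h] expects: the
    part [i] is counted at index [i - 1]. *)
Definition part_mult (a : nat) (s : seq nat) : {ffun 'I_a -> nat} :=
  [ffun j => count_mem (val j).+1 s].

(** Only the factor [p ^ m * m!] of [h] sees the removal, [m] being the
    multiplicity of [p]; it becomes [p ^ (m - 1) * (m - 1)!], smaller by the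
    factor [p * m]. *)
Lemma h_part_mult_rem (a : nat) (s : seq nat) (p : nat) :
  p \in s -> (0 < p <= a)%N ->
  h (part_mult a (rem p s)) = (p * count_mem p s)%:R * h (part_mult a s).
Proof.
case: p => // p ps /= lt_pa; pose i := Ordinal lt_pa.
rewrite /h (bigD1 i) //= [in RHS](bigD1 i) //= !ffunE /= !invfM mulrA.
have cnt q : count_mem q s = ((p.+1 == q) + count_mem q (rem p.+1 s))%N.
  by rewrite (permP (perm_to_rem ps)).
congr (_ * _^-1); last first.
  apply: eq_bigr => j ne_ji; rewrite !ffunE cnt.
  by rewrite eqSS (_ : p == j = false) //; apply/negbTE; rewrite eq_sym.
rewrite cnt eqxx add1n; set m := count_mem _ _.
rewrite exprS factS !natrM -!invfM.
have p0 : p.+1%:R != 0 :> rat by rewrite pnatr_eq0.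
have m0 : m.+1%:R != 0 :> rat by rewrite pnatr_eq0.
by rewrite [X in _ / X]mulrACA [X in _ = _ * X]invfM mulrA divff ?mul1r // mulf_neq0.
Qed.

(** The identity for an arbitrary multiset of parts, given by one of its
    enumerations [s]; in this form the induction on the number of parts goes
    through. *)
Lemma sum_H_permutations (a : nat) (s : seq nat) :
  all (fun p => 0 < p <= a)%N s ->
  \sum_(t <- permutations s) H t = h (part_mult a s).
Proof.
have [n le_sn] := ubnP (size s); elim: n s le_sn => // n IHn s.
have [s0 _ _|s_gt0 le_sn parts_s] := posnP (size s).
  rewrite (size0nil s0) big_seq1 /H /h big_ord0.
  by rewrite big1 // => j _; rewrite ffunE expr0 mul1r.
rewrite (perm_big _ (permutations_rcons _ _ s_gt0)) big_allpairs_dep /=.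
have sum_s0 : (sumn s)%:R != 0 :> rat.
  case: s s_gt0 parts_s {le_sn} => //= p s _ /andP[/andP[p_gt0 _] _].
  by rewrite pnatr_eq0 addn_eq0 negb_and -lt0n p_gt0.
transitivity (\sum_(p <- undup s)
    (p * count_mem p s)%:R * (h (part_mult a s) / (sumn s)%:R)).
  rewrite big_seq [RHS]big_seq; apply: eq_bigr => p; rewrite mem_undup => ps.
  rewrite mulrA -h_part_mult_rem //; last exact: (allP parts_s).
  rewrite -IHn; last 2 first.
  - by rewrite size_rem // prednK.
  - by apply/allP => q /mem_rem; apply: (allP parts_s).
  rewrite mulr_suml big_seq [RHS]big_seq; apply: eq_bigr => t.
  rewrite mem_permutations H_rcons => ts; congr (_ / _%:R).
  apply: perm_sumn; rewrite perm_rcons perm_sym (permPl (perm_to_rem ps)).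
  by rewrite perm_cons perm_sym.
rewrite -mulr_suml -natr_sum.
have -> : (\sum_(p <- undup s) p * count_mem p s)%N = sumn s.
  rewrite sumnE -[RHS]big_undup_iterop_count; apply: eq_bigr => p _.
  by rewrite Monoid.iteropE iter_addn_0.
by rewrite mulrC divfK.
Qed.

Definition parts_of_type {a : nat} (beta : {ffun 'I_a -> nat}) : seq nat :=
  flatten [seq nseq (beta j) (val j).+1 | j <- enum 'I_a].

Lemma parts_of_typeP {a : nat} (beta : {ffun 'I_a -> nat}) :
  all (fun p => 0 < p <= a)%N (parts_of_type beta).
Proof.
apply/allP => p /flatten_mapP[j _]; rewrite mem_nseq => /andP[_ /eqP->] /=.
exact: ltn_ord.
Qed.

Lemma sumn_parts_of_type (a : nat) (beta : {ffun 'I_a -> nat}) :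
  sumn (parts_of_type beta) = (\sum_(j < a) j.+1 * beta j)%N.
Proof.
rewrite sumn_flatten sumnE 2!big_map big_enum /=.
by apply: eq_bigr => j _; rewrite sumn_nseq.
Qed.

Lemma part_mult_parts_of_type {a : nat} (beta : {ffun 'I_a -> nat}) :
  part_mult a (parts_of_type beta) = beta.
Proof.
apply/ffunP => i; rewrite ffunE count_flatten sumnE 2!big_map big_enum /=.
rewrite (bigD1 i) //= count_nseq /= eqxx mul1n big1 ?addn0 // => j ne_ji.
by rewrite count_nseq /= eqSS (negbTE ne_ji : val j == val i = false) mul0n.
Qed.

(** The bounds matter: the vector does not see parts equal to [0] or larger
    than [a]. *)
Lemma perm_part_mult (a : nat) (s t : seq nat) :
    all (fun p => 0 < p <= a)%N s -> all (fun p => 0 < p <= a)%N t ->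
  part_mult a s = part_mult a t -> perm_eq s t.
Proof.
move=> parts_s parts_t eq_st; apply/allP => p; rewrite mem_cat => pst /=.
have : (0 < p <= a)%N.
  by case/orP: pst => [/(allP parts_s)|/(allP parts_t)].
case: p {pst} => // p /= lt_pa; apply/eqP.
by have /ffunP/(_ (Ordinal lt_pa)) := eq_st; rewrite !ffunE.
Qed.

Lemma mem_compositions_of_type (k a : nat) (beta : {ffun 'I_a -> nat})
    (alpha : composition k) :
  (alpha \in compositions_of_type k beta)
    = perm_eq alpha (parts_of_type beta).
Proof.
rewrite inE; apply/andP/idP => [[/forallP mult_alpha le_alpha]|eq_alpha].
  apply: (@perm_part_mult a); last 1 first.
  - rewrite part_mult_parts_of_type; apply/ffunP => j.
    by rewrite ffunE (eqP (mult_alpha j)).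
  - have /andP[/allP pos_alpha _] := valP alpha.
    by apply/allP => p p_alpha; rewrite pos_alpha //= (allP le_alpha).
  - exact: parts_of_typeP.
split.
  apply/forallP => j; rewrite (permP eq_alpha).
  by rewrite -{2}(part_mult_parts_of_type beta) ffunE.
rewrite (perm_all _ eq_alpha); apply: sub_all (parts_of_typeP beta).
by move=> p /andP[].
Qed.

Theorem lemma7 (k a : nat) (beta : {ffun 'I_a -> nat})
    (hk : (1 <= k)%N) (hbeta : (\sum_(j < a) j.+1 * beta j)%N = k) :
  \sum_(alpha in compositions_of_type k beta) H alpha = h beta.
Proof.
rewrite -{2}(part_mult_parts_of_type beta).
rewrite -sum_H_permutations ?parts_of_typeP //.
rewrite -big_enum -(big_map (@parts k) predT H) /=.
apply/perm_big/uniq_perm; last 1 first.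
- move=> t; rewrite mem_permutations; apply/mapP/idP => [[alpha]|eq_t].
    by rewrite mem_enum mem_compositions_of_type => ? ->.
  have comp_t : is_composition k t.
    rewrite /is_composition (perm_all _ eq_t) (perm_sumn eq_t).
    rewrite sumn_parts_of_type hbeta eqxx andbT.
    by apply: sub_all (parts_of_typeP beta) => p /andP[].
  exists (Composition comp_t) => //.
  by rewrite mem_enum mem_compositions_of_type.
- by rewrite (map_inj_uniq val_inj) enum_uniq.
- exact: permutations_uniq.
Qed.
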